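(* Let $p\in[2,\infty)$ and let $(Y,\mathcal{M},\mu)$ be a measure space with $\mu(Y)<\infty$. Let $(e_n)_{n\in\mathbb{N}^\star}$ be an orthonormal basis of $L^2(Y,\mathcal{M},\mu)$, let $(g_n)_{n\in\mathbb{N}^\star}$ be a sequence of independent $\mathcal{N}_{\mathbb{C}}(0,1)$ Gaussian random variables on a probability space $(\Omega,\mathcal{A},P)$, let $c=(c_n)_{n\in\mathbb{N}^\star}\in l^2(\mathbb{N}^\star)$, and consider the random series $$F_c(\omega)=\sum_{n\in\mathbb{N}^\star} g_n(\omega)\,c_n\,e_n .$$ If $$\sum_{n\in\mathbb{N}^\star}|c_n|^2\,\|e_n\|_{L^p(Y,\mathcal{M},\mu)}^2<\infty,$$ then $\|F_c(\omega)\|_{L^p(Y,\mathcal{M},\mu)}<\infty$ almost surely.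
   Context: $\mathbb{N}^\star=\{1,2,3,\dots\}$. $L^p$ and $l^2(\mathbb{N}^\star)$ are spaces of complex-valued functions and sequences. An $\mathcal{N}_{\mathbb{C}}(0,\sigma^2)$ Gaussian random variable ($\sigma>0$) is a complex-valued random variable with density $\frac{1}{2\pi\sigma^2}e^{-|z|^2/(2\sigma^2)}$ on $\mathbb{C}$; equivalently $X=X_1+iX_2$ with $X_1,X_2$ independent real centered Gaussians of variance $\sigma^2$, so $\mathbb{E}|X|^2=2\sigma^2$. The series $F_c$ is defined as the limit in $L^2(\Omega\times Y)$ (with respect to $P\otimes\mu$) of its partial sums; for $P$-almost every $\omega$, $F_c(\omega)\in L^2(Y,\mathcal{M},\mu)$ and its coordinates in the basis $(e_n)$ are $g_n(\omega)c_n$. For $f\in L^2(Y,\mathcal{M},\mu)$, $\|f\|_{L^p(Y,\mathcal{M},\mu)}=\left(\int_Y|f|^p\,d\mu\right)^{1/p}\in[0,\infty]$, with value $\infty$ if $f\notin L^p$. Convention: $0\cdot\infty=0$. *)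

(* Defs.v *)
(* MathComp-Analysis, with the complex numbers R[i] of mathcomp-real-closed. *)
From HB Require Import structures.
From mathcomp Require Import all_boot all_order all_algebra.
From mathcomp Require Import finmap.
From mathcomp Require Import all_classical all_reals all_analysis.
From mathcomp Require Import complex.
Set Implicit Arguments.
Unset Strict Implicit.
Unset Printing Implicit Defensive.
Import Order.TTheory GRing.Theory Num.Theory.
Import numFieldNormedType.Exports.

Local Open Scope classical_set_scope.
Local Open Scope ring_scope.

(* R[i] carries no sigma-algebra in the library: Borel sets of the complex
   plane are the measurable sets of R * R, through this identification. *)
Definition cpair (R : realType) (z : R[i]) : R * R :=
  (complex.Re z, complex.Im z).

Definition cmeasurable d (T : measurableType d) (R : realType)
    (f : T -> R[i]) : Prop :=
  measurable_fun [set: T] (fun x => cpair (f x)).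

Definition cLnorm d (T : measurableType d) (R : realType)
    (mu : {measure set T -> \bar R}) (p : R) (f : T -> R[i]) : \bar R :=
  'N[mu]_p%:E[ (fun x => (Normc.normc (f x))%:E) ]%E.

(* Elements of L^p are handled through representatives, so that equality in
   L^p is equality almost everywhere. *)
Definition cLfun d (T : measurableType d) (R : realType)
    (mu : {measure set T -> \bar R}) (p : R) (f : T -> R[i]) : Prop :=
  cmeasurable f /\ (cLnorm mu p f < +oo)%E.

Definition cintegral d (T : measurableType d) (R : realType)
    (mu : {measure set T -> \bar R}) (f : T -> R[i]) : R[i] :=
  Complex (Rintegral mu [set: T] (fun x => complex.Re (f x)))
          (Rintegral mu [set: T] (fun x => complex.Im (f x))).

Definition cinner d (T : measurableType d) (R : realType)
    (mu : {measure set T -> \bar R}) (f g : T -> R[i]) : R[i] :=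
  cintegral mu (fun x => f x * conjc (g x)).

Definition orthonormal_basis d (T : measurableType d) (R : realType)
    (mu : {measure set T -> \bar R}) (e : nat -> T -> R[i]) : Prop :=
  [/\ forall n, cLfun mu 2 (e n),
      forall m n, cinner mu (e m) (e n) = (m == n)%:R &
      forall f, cLfun mu 2 f -> forall eps : R, 0 < eps ->
        exists (N : nat) (a : nat -> R[i]),
          (cLnorm mu 2 (fun y => f y - \sum_(n < N) a n * e n y)%R < eps%:E)%E].

Definition complex_gaussian_pdf (R : realType) (s : R) (z : R * R) : R :=
  (2 * pi * s ^+ 2)^-1 * expR (- (z.1 ^+ 2 + z.2 ^+ 2) / (2 * s ^+ 2)).

(* The law N_C(0, s^2). *)
Definition complex_gaussian d (Omega : measurableType d) (R : realType)
    (P : probability Omega R) (s : R) (X : Omega -> R[i]) : Prop :=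
  cmeasurable X /\
  forall A : set (R * R), measurable A ->
    (P [set w | A (cpair (X w))] =
      \int[lebesgue_measure \x lebesgue_measure]_(z in A)
        (complex_gaussian_pdf s z)%:E)%E.

Definition cindependent d (Omega : measurableType d) (R : realType)
    (P : probability Omega R) (X : nat -> Omega -> R[i]) : Prop :=
  forall (J : {fset nat}) (A : nat -> set (R * R)),
    (forall n, measurable (A n)) ->
    (P (\bigcap_(n in [set` J]) [set w | A n (cpair (X n w))]) =
      \prod_(n <- J) P [set w | A n (cpair (X n w))])%E.

(* F is a representative of the sum of the g_n c_n e_n in L^2(P \x mu); the
   index n : nat stands for the positive integer n + 1. *)
Definition is_random_series d d' (Omega : measurableType d)
    (Y : measurableType d') (R : realType) (P : probability Omega R)
    (mu : {finite_measure set Y -> \bar R}) (g : nat -> Omega -> R[i])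
    (c : nat -> R[i]) (e : nat -> Y -> R[i]) (F : Omega * Y -> R[i]) : Prop :=
  cLfun (P \x mu)%E 2 F /\
  (fun N => cLnorm (P \x mu)%E 2
     (fun z => F z - \sum_(n < N) g n z.1 * c n * e n z.2)) @ \oo --> 0%E.

(* Main.v *)
Require Import Defs.
From HB Require Import structures.
From mathcomp Require Import all_boot all_order all_algebra.
From mathcomp Require Import finmap.
From mathcomp Require Import all_classical all_reals all_analysis.
From mathcomp Require Import complex.
From mathcomp Require Import measurable_realfun.
From mathcomp Require Import ring lra.
Import Order.TTheory GRing.Theory Num.Theory.
Import numFieldNormedType.Exports.

Local Open Scope classical_set_scope.
Local Open Scope ring_scope.

(** For a fixed point y, the N-th partial sum of the random series is a centred
    complex Gaussian variable whose variance is, up to a factor 2,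
    v_N(y) = sum over n < N of |c_n e_n(y)|^2, so that E |S_N(y)|^p is at most
    K v_N(y)^(p/2), with K depending only on p. Integrating over y,
      E ||S_N||_p^p <= K ||v_N||_(p/2)^(p/2),
    and since p/2 >= 1, Minkowski's inequality in L^(p/2) gives
    ||v_N||_(p/2) <= sum_n |c_n|^2 ||e_n||_p^2, which is finite by hypothesis.
    The bound is uniform in N, hence survives the passage to the limit in
    L^2(P x mu): the function F is in L^p(P x mu), and by Tonelli almost every
    section F(w, .) is in L^p(mu).

    The moment bound [gaussian_csum_moment] comes from exponential moments.
    With S = S_N(y) / sqrt(v_N(y)), the power |S|^p is dominated
    by a multiple of the sum of exp(Re(u S)) over u = 1, -1, i, -i, and each of
    these exponentials has expectation exp(1/2): by independence
    ([expectation_prod]) it factors into exponential moments of single Gaussian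
    variables, which are computed by completing squares ([gaussian_mgf]).

    The passage to the limit [integral_powR_closed_L2] is by truncation.
    Because p >= 2, min(|F|, k)^p is at most
    2^p |S_N|^p + 4 k^(p-2) |F - S_N|^2; one lets N tend to infinity, then k. *)

(** * Weighted integrals and independence *)

Section weighted_integrals.
Import HBNNSimple.

Lemma integral_weighted_simple {d d'} {T1 : measurableType d} {T : measurableType d'}
    {R : realType} (m : {measure set T1 -> \bar R}) (H : T1 -> R) (phi : T1 -> T)
    (g : {nnsfun T >-> R}) :
  measurable_fun setT H -> (forall x, 0 <= H x) -> measurable_fun setT phi ->
  (\int[m]_x (H x * g (phi x))%:E =
   \sum_(k \in range g) k%:E * \int[m]_x (H x * \1_(g @^-1` [set k]) (phi x))%:E)%E.
Proof.
move=> mH H0 mphi.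
have m1 k : measurable_fun setT (fun x => H x * \1_(g @^-1` [set k]) (phi x)).
  apply: measurable_funM => //.
  have mA : measurable (g @^-1` [set k]) by [].
  exact: (measurableT_comp (@measurable_indic _ _ R setT _ mA) mphi).
transitivity (\sum_(k \in range g)
    \int[m]_x (k%:E * (H x * \1_(g @^-1` [set k]) (phi x))%:E))%E; last first.
  apply: eq_fsbigr => k; rewrite inE => -[t _ <-].
  rewrite ge0_integralZl_EFin//.
  - by move=> x _; rewrite lee_fin mulr_ge0.
  - exact/measurable_EFinP.
rewrite -ge0_integral_fsum//.
- apply: eq_integral => x _; rewrite fimfunE mulr_fsumr -fsumEFin//.
  by apply: eq_fsbigr => k _; rewrite -EFinM mulrCA.
- by move=> k; apply: measurable_funeM; exact/measurable_EFinP.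
- move=> k x _; rewrite -EFinM mulrCA EFinM.
  rewrite mule_ge0 ?lee_fin//; exact: nnfun_muleindic_ge0.
Qed.

Lemma integral_weighted_lim {d d'} {T1 : measurableType d} {T : measurableType d'}
    {R : realType} (m : {measure set T1 -> \bar R}) (H : T1 -> R) (phi : T1 -> T)
    (f : T -> R) (mf : measurable_fun setT (EFin \o f)) :
  measurable_fun setT H -> (forall x, 0 <= H x) -> measurable_fun setT phi ->
  (forall t, 0 <= f t) ->
  (\int[m]_x (H x * f (phi x))%:E =
   limn (fun n => \int[m]_x (H x * nnsfun_approx measurableT mf n (phi x))%:E))%E.
Proof.
move=> mH H0 mphi f0; rewrite -monotone_convergence//.
- apply: eq_integral => x _; apply/esym/cvg_lim => //.
  rewrite EFinM; under eq_fun do rewrite EFinM.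
  apply: cvgeZl => //.
  by apply: (cvg_nnsfun_approx measurableT mf) => // t _; rewrite lee_fin.
- move=> n; apply/measurable_EFinP; apply: measurable_funM => //.
  exact: measurableT_comp.
- by move=> n x _; rewrite lee_fin mulr_ge0.
- move=> x _ a b ab; rewrite lee_fin ler_wpM2l//.
  exact/lefP/nd_nnsfun_approx.
Qed.

(** Two measures that agree on sets agree on nonnegative functions. Letting
    each measure be the image under a map [phi] of a measure with density [H]
    covers at once laws given by a density and independence. *)
Lemma integral_weighted_ext {d1 d2 d} {T1 : measurableType d1} {T2 : measurableType d2}
    {T : measurableType d} {R : realType}
    (m1 : {measure set T1 -> \bar R}) (m2 : {measure set T2 -> \bar R})
    (H1 : T1 -> R) (H2 : T2 -> R) (phi1 : T1 -> T) (phi2 : T2 -> T) (f : T -> R) :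
  measurable_fun setT H1 -> (forall x, 0 <= H1 x) -> measurable_fun setT phi1 ->
  measurable_fun setT H2 -> (forall x, 0 <= H2 x) -> measurable_fun setT phi2 ->
  measurable_fun setT f -> (forall t, 0 <= f t) ->
  (forall A, measurable A -> \int[m1]_x (H1 x * \1_A (phi1 x))%:E =
                             \int[m2]_x (H2 x * \1_A (phi2 x))%:E)%E ->
  (\int[m1]_x (H1 x * f (phi1 x))%:E = \int[m2]_x (H2 x * f (phi2 x))%:E)%E.
Proof.
move=> mH1 H10 mphi1 mH2 H20 mphi2 /measurable_EFinP mf f0 h.
rewrite !(integral_weighted_lim _ _ _ _ mf)//; congr (limn _); apply/funext => n.
rewrite !integral_weighted_simple//; apply: eq_fsbigr => k _; rewrite h//.
Qed.

End weighted_integrals.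

Lemma integral_prod_indic {d} {Omega : measurableType d} {R : realType}
    (P : probability Omega R) (X : nat -> Omega -> R[i]) (A : nat -> set (R * R)) (N : nat) :
  (forall n, cmeasurable (X n)) -> cindependent P X -> (forall n, measurable (A n)) ->
  (\int[P]_w (\prod_(i < N) \1_(A i) (cpair (X i w)))%:E =
   \prod_(i < N) P [set w | A i (cpair (X i w))])%E.
Proof.
move=> mX iX mA.
have mE n : measurable [set w | A n (cpair (X n w))].
  by rewrite -[X in measurable X]setTI; exact: mX.
pose J : {fset nat} := [fset i in iota 0 N]%fset.
have mI : measurable (\bigcap_(n in [set` J]) [set w | A n (cpair (X n w))]).
  by apply: fin_bigcap_measurable => // n _; exact: mE.
transitivity (\int[P]_w (\1_(\bigcap_(n in [set` J]) [set w | A n (cpair (X n w))]) w)%:E)%E.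
  apply: eq_integral => w _; congr EFin.
  have [wI|wI] := boolP (w \in \bigcap_(n in [set` J]) [set w | A n (cpair (X n w))]).
    rewrite indicE wI/= big1// => i _; rewrite indicE mem_set//.
    move: wI; rewrite inE; apply => /=.
    by rewrite !inE mem_iota/= add0n.
  rewrite indicE (negbTE wI)/=.
  suff [i Ai] : exists i : 'I_N, ~ A i (cpair (X i w)).
    by rewrite (bigD1 i)//= indicE memNset// mul0r.
  apply/existsNP => h; move/negP: wI; apply.
  rewrite inE => n /=; rewrite !inE mem_iota/= add0n => nN.
  exact: (h (Ordinal nN)).
rewrite integral_indic// setIT; apply: (etrans (iX J A mA)).
rewrite -(big_mkord xpredT (fun i => P [set w | A i (cpair (X i w))])).
rewrite /index_iota subn0; apply: perm_big; apply: uniq_perm.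
- exact: fset_uniq.
- exact: iota_uniq.
- by move=> i; rewrite !inE.
Qed.

(** Independence is the case where all the [f n] are indicators. The indicators
    are replaced by the given functions one index at a time: with the other
    factors frozen in a weight [Hk], both sides are integrals of the new factor
    against measures that agree on indicators. *)
Lemma expectation_prod {d} {Omega : measurableType d} {R : realType}
    (P : probability Omega R) (X : nat -> Omega -> R[i]) (f : nat -> R * R -> R)
    (m : nat -> R) (N : nat) :
  (forall n, cmeasurable (X n)) -> cindependent P X ->
  (forall n, measurable_fun setT (f n)) -> (forall n z, 0 <= f n z) ->
  (forall n, \int[P]_w (f n (cpair (X n w)))%:E = (m n)%:E)%E ->
  (\int[P]_w (\prod_(i < N) f i (cpair (X i w)))%:E = (\prod_(i < N) m i)%:E)%E.
Proof.
move=> mX iX.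
have mfX h n : measurable_fun setT h -> measurable_fun setT (fun w => h (cpair (X n w)) : R).
  by move=> mh; exact: (measurableT_comp mh (mX n)).
(* [k] counts the indices at which [f n] has already become arbitrary. *)
suff H (k : nat) : forall (f : nat -> R * R -> R) (m : nat -> R),
  (forall n, measurable_fun setT (f n)) -> (forall n z, 0 <= f n z) ->
  (forall n, (k <= n < N)%N -> exists2 A, measurable A & f n = \1_A) ->
  (forall n, \int[P]_w (f n (cpair (X n w)))%:E = (m n)%:E)%E ->
  (\int[P]_w (\prod_(i < N) f i (cpair (X i w)))%:E = (\prod_(i < N) m i)%:E)%E.
  by move=> mf f0 fm; apply: (H N) => // n; rewrite leqNgt andNb.
elim: k => [|k IH] {}f {}m mf f0 fA fm.
  have /choice[A hA] : forall n, exists A, measurable A /\ ((n < N)%N -> f n = \1_A).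
    move=> n; have [nN|_] := ltnP n N; last by exists setT.
    by have [//|A ? ?] := fA n; exists A.
  under eq_integral => w _.
    under eq_bigr => i _ do rewrite (hA i).2//.
    over.
  rewrite integral_prod_indic//; last by move=> n; exact: (hA n).1.
  rewrite -prodEFin; apply: eq_bigr => i _; rewrite -fm (hA i).2//.
  have mE : measurable [set w | A i (cpair (X i w))].
    by rewrite -[X in measurable X]setTI; apply: mX => //; exact: (hA i).1.
  by rewrite (integral_indic _ measurableT mE) setIT.
have [kN|Nk] := ltnP k N; last first.
  apply: IH => // n /andP[kn nN].
  by have := leq_ltn_trans (leq_trans Nk kn) nN; rewrite ltnn.
pose i0 := Ordinal kN.
pose Hk w := \prod_(i < N | i != i0) f i (cpair (X i w)).
pose c := \prod_(i < N | i != i0) m i.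
have m0 n : 0 <= m n.
  by rewrite -lee_fin -fm; apply: integral_ge0 => w _; rewrite lee_fin.
have c0 : 0 <= c by exact: prodr_ge0.
have mHk : measurable_fun setT Hk.
  rewrite /Hk; under eq_fun do rewrite -big_filter.
  by apply: measurable_prod => i _; exact: mfX.
have Hk0 w : 0 <= Hk w by exact: prodr_ge0.
transitivity (\int[P]_w (c * f k (cpair (X k w)))%:E)%E; last first.
  under eq_integral do rewrite EFinM.
  rewrite ge0_integralZl_EFin//.
  - by rewrite fm -EFinM mulrC [in RHS](bigD1 i0).
  - by move=> w _; rewrite lee_fin.
  - by apply/measurable_EFinP; exact: mfX.
transitivity (\int[P]_w (Hk w * f k (cpair (X k w)))%:E)%E.
  by apply: eq_integral => w _; rewrite mulrC (bigD1 i0).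
apply: (integral_weighted_ext _ _ Hk (cst c) (fun w => cpair (X k w))
  (fun w => cpair (X k w))) => //.
- exact: mX.
- exact: mX.
move=> A mA.
have mE : measurable [set w | A (cpair (X k w))].
  by rewrite -[X in measurable X]setTI; exact: mX.
pose f' n := if n == k then \1_A else f n.
pose m' n := if n == k then fine (P [set w | A (cpair (X k w))]) else m n.
have fm' n : (\int[P]_w (f' n (cpair (X n w)))%:E = (m' n)%:E)%E.
  rewrite /f' /m'; case: eqP => [->|//].
  by rewrite (integral_indic _ measurableT mE) setIT fineK ?fin_num_measure.
transitivity (\int[P]_w (\prod_(i < N) f' i (cpair (X i w)))%:E)%E.
  apply: eq_integral => w _; congr EFin; rewrite [RHS](bigD1 i0)//= mulrC.
  rewrite /f' eqxx; congr (_ * _); apply: eq_bigr => i /negbTE ii0.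
  by rewrite -(inj_eq val_inj)/= in ii0; rewrite ii0.
rewrite (IH f' m')//.
- rewrite (bigD1 i0)//= {1}/m' eqxx.
  have -> : \prod_(i < N | i != i0) m' i = c.
    apply: eq_bigr => i /negbTE ii0.
    by rewrite -(inj_eq val_inj)/= in ii0; rewrite /m' ii0.
  under [RHS]eq_integral do rewrite EFinM.
  rewrite ge0_integralZl_EFin//.
  + have := fm' k; rewrite /f' /m' eqxx => ->; by rewrite -EFinM mulrC.
  + by apply/measurable_EFinP; apply: mfX; exact: measurable_indic.
- by move=> n; rewrite /f'; case: eqP => // _; exact: measurable_indic.
- by move=> n z; rewrite /f'; case: eqP.
- move=> n /andP[kn nN]; rewrite /f'; case: eqP => [_|nk]; first by exists A.
  by apply: fA; rewrite nN ltn_neqAle kn !andbT eq_sym; apply/eqP.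
Qed.

(** * Exponential moments of a complex Gaussian variable *)

(** Completing the squares: multiplying the standard complex density by an
    exponential shifts its centre to [(al, be)]. *)
Lemma gaussian_pdf_tilt {R : realType} (al be : R) (z : R * R) :
  complex_gaussian_pdf 1 z * expR (al * z.1 + be * z.2) =
  expR ((al ^+ 2 + be ^+ 2) / 2) * (normal_pdf al 1 z.1 * normal_pdf be 1 z.2).
Proof.
rewrite /normal_pdf oner_eq0 /= /normal_fun /complex_gaussian_pdf.
have peak2 : normal_peak 1 * normal_peak 1 = (2 * pi * 1 ^+ 2)^-1 :> R.
  rewrite /normal_peak -invfM -expr2 sqr_sqrtr; last first.
    by rewrite mulrn_wge0// mulr_ge0// ?pi_ge0.
  by congr (_^-1); ring.
rewrite [X in _ = _ * X]mulrACA peak2 [RHS]mulrCA -[LHS]mulrA -!expRD.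
congr (_ * expR _); by field.
Qed.

Lemma gaussian_mgf {d} {Omega : measurableType d} {R : realType}
    (P : probability Omega R) (X : Omega -> R[i]) (al be : R) :
  complex_gaussian P 1 X ->
  (\int[P]_w (expR (al * (cpair (X w)).1 + be * (cpair (X w)).2))%:E =
   (expR ((al ^+ 2 + be ^+ 2) / 2))%:E)%E.
Proof.
move=> [mX lawX].
have mpdf : measurable_fun setT (complex_gaussian_pdf (1 : R)).
  apply: measurable_funM => //; apply: measurableT_comp => //.
  apply: measurable_funM => //; apply: measurableT_comp => //.
  by apply: measurable_funD; apply: measurable_funX => //.
have mlin : measurable_fun setT (fun z : R * R => expR (al * z.1 + be * z.2)).
  apply: measurableT_comp => //; apply: measurable_funD; apply: measurable_funM => //.
have pdf0 (z : R * R) : 0 <= complex_gaussian_pdf 1 z.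
  by rewrite mulr_ge0 ?invr_ge0 ?expR_ge0// !mulr_ge0// pi_ge0.
transitivity (\int[P]_w (1 * expR (al * (cpair (X w)).1 + be * (cpair (X w)).2))%:E)%E.
  by apply: eq_integral => w _; rewrite mul1r.
rewrite (integral_weighted_ext P (lebesgue_measure \x lebesgue_measure)%E (cst 1)
  (complex_gaussian_pdf 1) (fun w => cpair (X w)) id
  (fun z => expR (al * z.1 + be * z.2)))//; last first.
- move=> A mA; under eq_integral do rewrite mul1r.
  have mE : measurable [set w | A (cpair (X w))].
    by rewrite -[X in measurable X]setTI; exact: mX.
  rewrite (integral_indic _ measurableT mE) setIT.
  apply: (etrans (lawX A mA)).
  rewrite [LHS]integral_mkcond; apply: eq_integral => z _.
  rewrite patchE indicE; case: ifPn => /= _; by rewrite ?mulr1 ?mulr0.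
transitivity (\int[(lebesgue_measure \x lebesgue_measure)]_z
  ((expR ((al ^+ 2 + be ^+ 2) / 2))%:E *
   (normal_pdf al 1 z.1 * normal_pdf be 1 z.2)%:E))%E.
  by apply: eq_integral => z _; rewrite gaussian_pdf_tilt EFinM.
have mN : measurable_fun setT (fun z : R * R => (normal_pdf al 1 z.1 * normal_pdf be 1 z.2)%:E).
  apply/measurable_EFinP; apply: measurable_funM;
    by apply: measurableT_comp => //; exact: measurable_normal_pdf.
have N0 (z : R * R) : (0 <= (normal_pdf al 1 z.1 * normal_pdf be 1 z.2)%:E)%E.
  by rewrite lee_fin mulr_ge0// normal_pdf_ge0.
rewrite ge0_integralZl_EFin ?expR_ge0//.
rewrite fubini_tonelli1// /fubini_F/=.
under eq_integral => x _.
  under eq_integral do rewrite EFinM.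
  rewrite ge0_integralZl_EFin//.
  - over.
  - by move=> y _; rewrite lee_fin normal_pdf_ge0.
  - by apply/measurable_EFinP; exact: measurable_normal_pdf.
  - exact: normal_pdf_ge0.
under eq_integral do rewrite integral_normal_pdf mule1.
by rewrite integral_normal_pdf mule1.
Qed.

(** * Measurability and size of complex-valued functions *)

Lemma cmeasurableP {d} {T : measurableType d} {R : realType} (f : T -> R[i]) :
  cmeasurable f <-> measurable_fun setT (fun x => complex.Re (f x)) /\
                    measurable_fun setT (fun x => complex.Im (f x)).
Proof.
split=> [mf|[mRe mIm]]; last exact: measurable_fun_pair.
split.
- exact: (measurableT_comp measurable_fst mf).
- exact: (measurableT_comp measurable_snd mf).
Qed.

Lemma cmeasurable_cst {d} {T : measurableType d} {R : realType} (c : R[i]) :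
  cmeasurable (fun _ : T => c).
Proof. exact: measurable_cst. Qed.

Lemma cmeasurableD {d} {T : measurableType d} {R : realType} (f g : T -> R[i]) :
  cmeasurable f -> cmeasurable g -> cmeasurable (fun x => f x + g x).
Proof.
move=> /cmeasurableP[f1 f2] /cmeasurableP[g1 g2]; apply/cmeasurableP; split.
- rewrite (_ : (fun _ => _) = (fun x => complex.Re (f x) + complex.Re (g x))).
    exact: measurable_funD.
  by apply/funext => x; case: (f x) => a b; case: (g x).
- rewrite (_ : (fun _ => _) = (fun x => complex.Im (f x) + complex.Im (g x))).
    exact: measurable_funD.
  by apply/funext => x; case: (f x) => a b; case: (g x).
Qed.

Lemma cmeasurableM {d} {T : measurableType d} {R : realType} (f g : T -> R[i]) :
  cmeasurable f -> cmeasurable g -> cmeasurable (fun x => f x * g x).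
Proof.
move=> /cmeasurableP[f1 f2] /cmeasurableP[g1 g2]; apply/cmeasurableP; split.
- rewrite (_ : (fun _ => _) = (fun x => complex.Re (f x) * complex.Re (g x) -
                                  complex.Im (f x) * complex.Im (g x))).
    by apply: measurable_funB; exact: measurable_funM.
  by apply/funext => x; case: (f x) => a b; case: (g x).
- rewrite (_ : (fun _ => _) = (fun x => complex.Re (f x) * complex.Im (g x) +
                                  complex.Im (f x) * complex.Re (g x))).
    by apply: measurable_funD; exact: measurable_funM.
  by apply/funext => x; case: (f x) => a b; case: (g x).
Qed.

Lemma cmeasurable_sum {d} {T : measurableType d} {R : realType} (N : nat)
    (f : nat -> T -> R[i]) :
  (forall n, cmeasurable (f n)) -> cmeasurable (fun x => \sum_(n < N) f n x).
Proof.
move=> mf; elim: N => [|N IH].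
  by under eq_fun do rewrite big_ord0; exact: cmeasurable_cst.
by under eq_fun do rewrite big_ord_recr; exact: cmeasurableD.
Qed.

Lemma cmeasurable_comp {d d'} {T : measurableType d} {T' : measurableType d'}
    {R : realType} (f : T -> R[i]) (h : T' -> T) :
  cmeasurable f -> measurable_fun setT h -> cmeasurable (f \o h).
Proof. by move=> mf mh; exact: (measurableT_comp mf mh). Qed.

Lemma normc_sqr {R : rcfType} (z : R[i]) :
  Normc.normc z ^+ 2 = complex.Re z ^+ 2 + complex.Im z ^+ 2.
Proof. by case: z => a b /=; rewrite sqr_sqrtr// addr_ge0 ?sqr_ge0. Qed.

Lemma normc_ge0 {R : rcfType} (z : R[i]) : 0 <= Normc.normc z.
Proof. by case: z => a b /=; exact: sqrtr_ge0. Qed.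

Lemma measurable_normc {d} {T : measurableType d} {R : realType} (f : T -> R[i]) :
  cmeasurable f -> measurable_fun setT (fun x => Normc.normc (f x)).
Proof.
move=> /cmeasurableP[f1 f2].
rewrite (_ : (fun _ => _) = (fun x => Num.sqrt (complex.Re (f x) ^+ 2 + complex.Im (f x) ^+ 2))).
  apply: (measurableT_comp (continuous_measurable_fun (@sqrt_continuous R))).
  by apply: measurable_funD; exact: measurable_funX.
by apply/funext => x; case: (f x).
Qed.

Lemma measurable_normc_powR {d} {T : measurableType d} {R : realType} (f : T -> R[i]) (p : R) :
  cmeasurable f -> measurable_fun setT (fun x => Normc.normc (f x) `^ p).
Proof.
by move=> /measurable_normc mf; exact: (measurableT_comp (measurable_powR p) mf).
Qed.

Lemma normc_le {R : rcfType} (z : R[i]) :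
  Normc.normc z <= `|complex.Re z| + `|complex.Im z|.
Proof.
rewrite -(@ler_pXn2r _ 2)// ?nnegrE ?addr_ge0 ?normc_ge0//.
rewrite normc_sqr sqrrD !real_normK ?num_real// -addrA lerD2l lerDr.
by rewrite mulrn_wge0// mulr_ge0.
Qed.

(** This is [x <= expR x] at [x = t / p], raised to the power [p]. *)
Lemma powR_le_expR {R : realType} (p t : R) : 0 < p -> 0 <= t ->
  t `^ p <= p `^ p * expR t.
Proof.
move=> p0 t0.
have h : t <= p * expR (t / p).
  rewrite mulrC -ler_pdivrMr//; apply: le_trans (expR_ge1Dx _).
  by rewrite lerDr.
have -> : expR t = expR (t / p) `^ p.
  by rewrite -expRM divfK// gt_eqF.
rewrite -powRM ?expR_ge0 ?(ltW p0)//; apply: ge0_ler_powR; rewrite ?nnegrE ?(ltW p0)//.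
by rewrite mulr_ge0 ?expR_ge0// ltW.
Qed.

(** The directions [u] along which [Re (u * z)] is one of Re z, - Re z, - Im z
    and Im z: the largest of these four numbers is at least |z| / 2. *)
Definition quarter_turns {R : realType} : seq R[i] := [:: 1; -1; 'i%C; - 'i%C].

Lemma normc_powR_le_expR {R : realType} (p : R) (z : R[i]) : 0 < p ->
  Normc.normc z `^ p <= (2 * p) `^ p *
    \sum_(u <- quarter_turns) expR (complex.Re (u * z)).
Proof.
move=> p0; rewrite /quarter_turns !big_cons big_nil addr0; case: z => a b /=.
rewrite !(mul0r, mulr0, oppr0, mul1r, mulN1r, sub0r, opprK, add0r, addr0).
set m := Num.max `|a| `|b|.
have m0 : 0 <= m by rewrite le_max normr_ge0.
have abm : Normc.normc (a +i* b)%C <= 2 * m.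
  apply: le_trans (normc_le _) _; rewrite /= mulr_natl mulr2n.
  by rewrite lerD// le_max lexx ?orbT.
apply: (@le_trans _ _ ((2 * m) `^ p)).
  apply: ge0_ler_powR; rewrite ?nnegrE ?(ltW p0) ?sqrtr_ge0//.
  by rewrite mulr_ge0.
rewrite !powRM// ?(ltW p0)//.
rewrite -mulrA ler_wpM2l ?powR_ge0//.
apply: (le_trans (powR_le_expR p m p0 m0)); rewrite ler_wpM2l ?powR_ge0//.
have [ea|ea|ea|ea] : [\/ m = a, m = - a, m = b | m = - b].
  rewrite /m; case: (lerP `|a| `|b|) => _.
  - have [b0|b0] := lerP 0 b; first by rewrite ger0_norm//; constructor 3.
    by rewrite ltr0_norm//; constructor 4.
  - have [a0|a0] := lerP 0 a; first by rewrite ger0_norm//; constructor 1.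
    by rewrite ltr0_norm//; constructor 2.
all: rewrite ea; have := expR_ge0 a; have := expR_ge0 (- a);
  have := expR_ge0 b; have := expR_ge0 (- b); lra.
Qed.

(** * Moments of sums of independent Gaussian variables *)

Lemma gaussian_sum_mgf {d} {Omega : measurableType d} {R : realType}
    (P : probability Omega R) (g : nat -> Omega -> R[i])
    (al be : nat -> R) (N : nat) :
  (forall n, complex_gaussian P 1 (g n)) -> cindependent P g ->
  (\int[P]_w (expR (\sum_(n < N) (al n * complex.Re (g n w) + be n * complex.Im (g n w))))%:E =
   (expR ((\sum_(n < N) (al n ^+ 2 + be n ^+ 2)) / 2))%:E)%E.
Proof.
move=> gauss_g indep_g; pose f n (z : R * R) := expR (al n * z.1 + be n * z.2).
under eq_integral do rewrite expR_sum.
rewrite (expectation_prod P g f (fun n => expR ((al n ^+ 2 + be n ^+ 2) / 2)))//.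
- by rewrite -expR_sum mulr_suml.
- by move=> n; exact: (gauss_g n).1.
- move=> n; apply: measurableT_comp => //; apply: measurable_funD; apply: measurable_funM => //.
- by move=> n z; exact: expR_ge0.
- by move=> n; exact: gaussian_mgf.
Qed.

Lemma gaussian_csum_mgf {d} {Omega : measurableType d} {R : realType}
    (P : probability Omega R) (g : nat -> Omega -> R[i])
    (a : nat -> R[i]) (b : R[i]) (N : nat) :
  (forall n, complex_gaussian P 1 (g n)) -> cindependent P g ->
  (\int[P]_w (expR (complex.Re (b * \sum_(n < N) g n w * a n)))%:E =
   (expR (Normc.normc b ^+ 2 * (\sum_(n < N) Normc.normc (a n) ^+ 2) / 2))%:E)%E.
Proof.
move=> gauss_g indep_g.
pose al n := complex.Re (b * a n); pose be n := - complex.Im (b * a n).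
have -> : Normc.normc b ^+ 2 * (\sum_(n < N) Normc.normc (a n) ^+ 2) =
    \sum_(n < N) (al n ^+ 2 + be n ^+ 2).
  rewrite mulr_sumr; apply: eq_bigr => n _.
  by rewrite /al /be sqrrN -normc_sqr -exprMn Normc.normcM.
rewrite -(gaussian_sum_mgf P g)//; apply: eq_integral => w _; congr (expR _)%:E.
rewrite mulr_sumr raddf_sum; apply: eq_bigr => n _.
rewrite mulrCA mulrC /al /be; case: (b * a n) => x y; case: (g n w) => u v /=.
by rewrite mulNr.
Qed.

Definition moment_cst {R : realType} (p : R) : R := (2 * p) `^ p * (4 * expR 2^-1).

(** Multiplying the sum by [la], the inverse square root of [v], makes the
    exponential moments of [gaussian_csum_mgf] equal to [expR 2^-1] in every
    direction [u] of modulus 1, so that [normc_powR_le_expR] costs a constant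
    independent of [a] and [N]. *)
Lemma gaussian_csum_moment {d} {Omega : measurableType d} {R : realType}
    (P : probability Omega R) (g : nat -> Omega -> R[i])
    (p : R) (a : nat -> R[i]) (N : nat) : 0 < p ->
  (forall n, complex_gaussian P 1 (g n)) -> cindependent P g ->
  (\int[P]_w (Normc.normc (\sum_(n < N) g n w * a n) `^ p)%:E <=
   (moment_cst p * (\sum_(n < N) Normc.normc (a n) ^+ 2) `^ (p / 2))%:E)%E.
Proof.
move=> p0 gauss_g indep_g; set v := \sum_(n < N) Normc.normc (a n) ^+ 2.
pose S w := \sum_(n < N) g n w * a n.
have v0 : 0 <= v by apply: sumr_ge0 => n _; exact: sqr_ge0.
have mS : cmeasurable S.
  apply: (cmeasurable_sum N (fun n w => g n w * a n)) => n.
  by apply: cmeasurableM; [exact: (gauss_g n).1|exact: cmeasurable_cst].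
have p20 : p / 2 != 0 by rewrite gt_eqF// divr_gt0.
(* If [v = 0] the normalisation is impossible, but then the sum vanishes. *)
have [v00|vN0] := eqVneq v 0.
  have a0 (n : 'I_N) : a n = 0.
    apply: Normc.eq0_normc; apply/eqP; rewrite -sqrf_eq0; apply/eqP.
    by apply: (psumr_eq0P _ v00) => // i _; exact: sqr_ge0.
  rewrite v00 powR0// mulr0.
  under eq_integral => w _.
    rewrite big1; last by move=> n _; rewrite a0 mulr0.
    rewrite Normc.normc0 powR0 ?gt_eqF//.
    over.
  by rewrite integral0.
have {vN0}vgt0 : 0 < v by rewrite lt_def vN0.
pose la : R[i] := ((Num.sqrt v)^-1)%:C%C.
have sv0 : 0 < Num.sqrt v by rewrite sqrtr_gt0.
have nla : Normc.normc la ^+ 2 * v = 1.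
  by rewrite normc_sqr /= expr0n addr0 exprVn sqr_sqrtr// mulVf// gt_eqF.
have scale w : Normc.normc (S w) `^ p = v `^ (p / 2) * Normc.normc (la * S w) `^ p.
  have -> : v `^ (p / 2) = Num.sqrt v `^ p by rewrite mulrC powRrM powR12_sqrt.
  rewrite Normc.normcM /= expr0n addr0 sqrtr_sqr ger0_norm ?invr_ge0 ?ltW//.
  rewrite -powRM ?mulr_ge0 ?invr_ge0 ?normc_ge0 ?ltW//.
  by rewrite mulrA divff ?mul1r// gt_eqF.
under eq_integral do rewrite -/(S _) scale EFinM.
have mlS u : cmeasurable (fun w => u * S w).
  by apply: cmeasurableM => //; exact: cmeasurable_cst.
rewrite ge0_integralZl_EFin ?powR_ge0//; last 2 first.
  by move=> w _; rewrite lee_fin powR_ge0.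
  by apply/measurable_EFinP; exact: measurable_normc_powR.
rewrite [moment_cst p * _]mulrC EFinM lee_wpmul2l ?lee_fin ?powR_ge0//.
pose E u w : \bar R := (expR (complex.Re (u * S w)))%:E.
have E0 u w : (0 <= E u w)%E by rewrite lee_fin expR_ge0.
have mE u : measurable_fun setT (E u).
  apply/measurable_EFinP; apply: measurableT_comp => //.
  by have /cmeasurableP[] := mlS u.
have intE u : Normc.normc u = 1 -> (\int[P]_w E (u * la)%R w = (expR 2^-1)%:E)%E.
  by move=> u1; rewrite /E (gaussian_csum_mgf P g)// Normc.normcM u1 mul1r nla mul1r.
apply: (@le_trans _ _ (\int[P]_w (((2 * p) `^ p)%:E *
    \sum_(u <- quarter_turns) E (u * la)%R w))%E).
  apply: ge0_le_integral => //.
  - by move=> w _; rewrite lee_fin powR_ge0.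
  - by apply/measurable_EFinP; exact: measurable_normc_powR.
  - by apply: measurable_funeM; exact: emeasurable_sum.
  - move=> w _; rewrite /E sumEFin -EFinM lee_fin.
    apply: (le_trans (normc_powR_le_expR p _ p0)).
    by rewrite ler_wpM2l ?powR_ge0//; under eq_bigr do rewrite mulrA.
rewrite ge0_integralZl_EFin ?powR_ge0//; last 2 first.
  by move=> w _; exact: sume_ge0.
  exact: emeasurable_sum.
rewrite /moment_cst EFinM lee_wpmul2l ?lee_fin ?powR_ge0//.
have normc_i : Normc.normc ('i%C : R[i]) = 1.
  by rewrite /= expr0n expr1n add0r sqrtr1.
rewrite ge0_integral_sum// /quarter_turns !big_cons big_nil.
rewrite !intE ?normcN ?Normc.normc1//.
by rewrite -!EFinD lee_fin; lra.
Qed.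

(** * The variance function in L^(p/2) *)

Lemma poweR2 {R : realType} (x : \bar R) : (0 <= x -> x `^ 2 = x ^+ 2)%E.
Proof.
case: x => [r| |//]; first by rewrite lee_fin => r0; rewrite poweR_EFin powR_mulrn// EFin_expe.
by move=> _; rewrite poweRyr.
Qed.

Lemma cLnormE {d} {T : measurableType d} {R : realType}
    (mu : {measure set T -> \bar R}) (p : R) (f : T -> R[i]) :
  (cLnorm mu p f = (\int[mu]_x (Normc.normc (f x) `^ p)%:E) `^ p^-1)%E.
Proof.
rewrite /cLnorm unlock; congr (_ `^ _)%E; apply: eq_integral => x _.
by rewrite /= ger0_norm ?normc_ge0.
Qed.

Lemma Lnorm_sqr_normc {d} {T : measurableType d} {R : realType}
    (mu : {measure set T -> \bar R}) (p : R) (c : R[i]) (f : T -> R[i]) :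
  0 < p -> cmeasurable f ->
  ('N[mu]_(p / 2)%:E[EFin \o (fun x => (Normc.normc (c * f x) ^+ 2)%R)] =
   (Normc.normc c ^+ 2)%:E * cLnorm mu p f ^+ 2)%E.
Proof.
move=> p0 mf; rewrite unlock.
have pN0 : p != 0 by rewrite gt_eqF.
transitivity (((Normc.normc c `^ p)%:E * \int[mu]_x (Normc.normc (f x) `^ p)%:E) `^ (p / 2)^-1)%E.
  congr (_ `^ _)%E; rewrite -ge0_integralZl_EFin ?powR_ge0//.
  - apply: eq_integral => x _; rewrite /= ger0_norm ?sqr_ge0// -EFinM.
    rewrite -powRM ?normc_ge0// -Normc.normcM -powR_mulrn ?normc_ge0//.
    by rewrite -powRrM mulrCA divff// mulr1.
  - by move=> x _; rewrite lee_fin powR_ge0.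
  - by apply/measurable_EFinP; exact: measurable_normc_powR.
have I0 : (0 <= \int[mu]_x (Normc.normc (f x) `^ p)%:E)%E.
  by apply: integral_ge0 => x _; rewrite lee_fin powR_ge0.
rewrite poweRM// ?lee_fin ?powR_ge0//.
rewrite invf_div [2 / p]mulrC !poweRrM -cLnormE !poweR2//.
- rewrite poweR_EFin -powRrM divff// powRr1 ?normc_ge0// EFin_expe//.
- exact: Lnorm_ge0.
- exact: poweR_ge0.
Qed.

(** Minkowski's inequality in L^(p/2), which is a norm since [2 <= p]. *)
Lemma Lnorm_sum_sqr {d} {T : measurableType d} {R : realType}
    (mu : {measure set T -> \bar R}) (p : R) (c : nat -> R[i]) (f : nat -> T -> R[i])
    (N : nat) :
  2 <= p -> (forall n, cmeasurable (f n)) ->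
  ('N[mu]_(p / 2)%:E[EFin \o (fun x => \sum_(n < N) Normc.normc (c n * f n x) ^+ 2)%R] <=
   \sum_(n < N) (Normc.normc (c n) ^+ 2)%:E * cLnorm mu p (f n) ^+ 2)%E.
Proof.
move=> p2 mf; have p0 : 0 < p by apply: lt_le_trans p2.
have mcf n : measurable_fun setT (fun x => Normc.normc (c n * f n x) ^+ 2).
  apply: measurable_funX; apply: measurable_normc.
  by apply: cmeasurableM => //; exact: cmeasurable_cst.
elim: N => [|N IH].
  rewrite big_ord0 (_ : _ \o _ = cst 0%E) ?Lnorm0//.
  - by rewrite eqe gt_eqF// divr_gt0.
  - by apply/funext => x /=; rewrite big_ord0.
rewrite big_ord_recr/= -Lnorm_sqr_normc//.
apply: le_trans (leeD IH (lexx _)).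
rewrite (_ : (fun x => _) = (fun x => \sum_(n < N) Normc.normc (c n * f n x) ^+ 2) \+
   (fun x => Normc.normc (c N * f N x) ^+ 2)); last first.
  by apply/funext => x; rewrite big_ord_recr.
apply: minkowski_EFin => //; first exact: measurable_sum.
by rewrite ler_pdivlMr// mul1r.
Qed.

Lemma integral_sum_sqr {d} {T : measurableType d} {R : realType}
    (mu : {measure set T -> \bar R}) (p : R) (c : nat -> R[i]) (f : nat -> T -> R[i])
    (N : nat) :
  2 <= p -> (forall n, cmeasurable (f n)) ->
  (\int[mu]_x ((\sum_(n < N) Normc.normc (c n * f n x) ^+ 2) `^ (p / 2))%:E <=
   (\sum_(n <oo) (Normc.normc (c n) ^+ 2)%:E * cLnorm mu p (f n) ^+ 2) `^ (p / 2))%E.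
Proof.
move=> p2 mf; have p0 : 0 < p by apply: lt_le_trans p2.
have h0 n : (0 <= (Normc.normc (c n) ^+ 2)%:E * cLnorm mu p (f n) ^+ 2)%E.
  by rewrite mule_ge0 ?lee_fin ?sqr_ge0// mule_ge0// Lnorm_ge0.
pose h := (fun x => \sum_(n < N) Normc.normc (c n * f n x) ^+ 2).
rewrite (_ : \int[mu]_x _ = 'N[mu]_(p / 2)%:E[EFin \o h] `^ (p / 2))%E; last first.
  rewrite poweR_Lnorm ?gt_eqF ?divr_gt0//; apply: eq_integral => x _.
  by rewrite /= ger0_norm// sumr_ge0// => n _; exact: sqr_ge0.
apply: gt0_ler_poweR; rewrite ?in_itv/= ?leey ?andbT//.
- by rewrite divr_ge0// ltW.
- exact: Lnorm_ge0.
- by apply: nneseries_ge0 => *.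
apply: (le_trans (Lnorm_sum_sqr mu p c f N p2 mf)).
rewrite -(big_mkord xpredT (fun n => (Normc.normc (c n) ^+ 2)%:E * cLnorm mu p (f n) ^+ 2)%E).
exact: nneseries_lim_ge.
Qed.

(** * L^p bounds along L^2-convergent sequences *)

(** If |x| <= 2|y| the first term suffices. Otherwise |x| <= 2|x - y|, and two of
    the [p] factors of the left-hand side are bounded by 2|x - y|, the others by
    [k]. *)
Lemma min_powR_le {R : realType} (p k : R) (x y : R[i]) : 2 <= p -> 0 <= k ->
  Num.min (Normc.normc x) k `^ p <=
  2 `^ p * Normc.normc y `^ p + 4 * k `^ (p - 2) * Normc.normc (x - y) ^+ 2.
Proof.
move=> p2 k0; have p0 : 0 < p by apply: lt_le_trans p2.
set t := Num.min _ _.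
have t0 : 0 <= t by rewrite le_min normc_ge0.
have tx : t <= Normc.normc x by rewrite ge_min lexx.
have tk : t <= k by rewrite ge_min lexx orbT.
have [xy|xy] := leP (Normc.normc x) (2 * Normc.normc y).
  apply: ler_wpDr; first by rewrite mulr_ge0 ?sqr_ge0// mulr_ge0// powR_ge0.
  rewrite -powRM ?normc_ge0//; apply: ge0_ler_powR; rewrite ?nnegrE ?(ltW p0)//.
  - by rewrite mulr_ge0 ?normc_ge0.
  - exact: le_trans tx xy.
apply: ler_wpDl; first by rewrite mulr_ge0 ?powR_ge0//.
have t2 : t <= 2 * Normc.normc (x - y).
  have := le_normcD y (x - y); rewrite subrKC => h.
  by apply: (le_trans tx); lra.
have -> : t `^ p = t `^ (p - 2) * t ^+ 2.
  rewrite -powR_mulrn// -powRD ?subrK//.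
  by rewrite gt_eqF.
rewrite [4 * _]mulrC -mulrA; apply: ler_pM; rewrite ?powR_ge0 ?sqr_ge0//.
  by apply: ge0_ler_powR; rewrite ?nnegrE// subr_ge0.
have -> : 4 * Normc.normc (x - y) ^+ 2 = (2 * Normc.normc (x - y)) ^+ 2 by ring.
by rewrite ler_pXn2r// nnegrE mulr_ge0 ?normc_ge0.
Qed.

(** At a fixed truncation level [k] the error term of [min_powR_le] tends to 0 as
    [N] grows; monotone convergence then removes the truncation. *)
Lemma integral_powR_closed_L2 {d} {T : measurableType d} {R : realType}
    (mu : {measure set T -> \bar R}) (p : R) (f : T -> R[i]) (s : nat -> T -> R[i])
    (B : \bar R) :
  2 <= p -> cmeasurable f -> (forall N, cmeasurable (s N)) ->
  (fun N => cLnorm mu 2 (fun x => f x - s N x)) @ \oo --> 0%E ->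
  (forall N, \int[mu]_x (Normc.normc (s N x) `^ p)%:E <= B)%E ->
  (\int[mu]_x (Normc.normc (f x) `^ p)%:E <= (2 `^ p)%:E * B)%E.
Proof.
move=> p2 mf ms cvg_s sB; have p0 : 0 < p by apply: lt_le_trans p2.
have mfs N : cmeasurable (fun x => f x - s N x).
  rewrite (_ : (fun x => _) = (fun x => f x + (-1) * s N x)).
    apply: cmeasurableD => //; apply: cmeasurableM => //; exact: cmeasurable_cst.
  by apply/funext => x; rewrite mulN1r.
pose h (k : nat) x := (Num.min (Normc.normc (f x)) k%:R `^ p)%:E.
have mh k : measurable_fun setT (h k).
  apply/measurable_EFinP; apply: (measurableT_comp (measurable_powR p)).
  by apply: measurable_minr => //; exact: measurable_normc.
have h0 k x : (0 <= h k x)%E by rewrite lee_fin powR_ge0.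
have min0 x (k : nat) : 0 <= Num.min (Normc.normc (f x)) k%:R :> R.
  by rewrite le_min normc_ge0/=.
have nd_h x : nondecreasing_seq (h ^~ x).
  move=> a b ab; rewrite lee_fin; apply: ge0_ler_powR; rewrite ?nnegrE ?(ltW p0)//.
  by rewrite le_min ge_min lexx/= ge_min ler_nat ab orbT.
have hB k : (\int[mu]_x h k x <= (2 `^ p)%:E * B)%E.
  pose C : R := 4 * k%:R `^ (p - 2).
  have C0 : 0 <= C by rewrite mulr_ge0// powR_ge0.
  have bound N : (\int[mu]_x h k x <= (2 `^ p)%:E * B +
      C%:E * cLnorm mu 2 (fun x => (f x - s N x)%R) ^+ 2)%E.
    have -> : (cLnorm mu 2 (fun x => (f x - s N x)%R) ^+ 2 =
        \int[mu]_x (Normc.normc (f x - s N x) ^+ 2)%:E)%E.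
      rewrite -poweR2 ?Lnorm_ge0// /cLnorm poweR_Lnorm//.
      apply: eq_integral => x _.
      by rewrite /= ger0_norm ?normc_ge0// powR_mulrn// normc_ge0.
    have m1 : measurable_fun setT (fun x => (Normc.normc (s N x) `^ p)%:E).
      by apply/measurable_EFinP; exact: measurable_normc_powR.
    have m2 : measurable_fun setT (fun x => (Normc.normc (f x - s N x) ^+ 2)%:E).
      by apply/measurable_EFinP; apply: measurable_funX; exact: measurable_normc.
    apply: (@le_trans _ _ (\int[mu]_x ((2 `^ p)%:E * (Normc.normc (s N x) `^ p)%:E +
       C%:E * (Normc.normc (f x - s N x) ^+ 2)%:E))%E).
      apply: ge0_le_integral => //.
      - by apply: emeasurable_funD; exact: measurable_funeM.
      - move=> x _; rewrite -!EFinM -EFinD lee_fin.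
        exact: min_powR_le.
    rewrite ge0_integralD//; last 4 first.
    - by move=> x _; rewrite mule_ge0 ?lee_fin ?powR_ge0.
    - exact: measurable_funeM.
    - by move=> x _; rewrite mule_ge0 ?lee_fin ?sqr_ge0.
    - exact: measurable_funeM.
    rewrite !ge0_integralZl_EFin ?powR_ge0//; last 2 first.
    - by move=> x _; rewrite lee_fin sqr_ge0.
    - by move=> x _; rewrite lee_fin powR_ge0.
    by apply: leeD => //; rewrite lee_wpmul2l ?lee_fin ?powR_ge0.
  have cvgb : (fun N => (2 `^ p)%:E * B +
      C%:E * cLnorm mu 2 (fun x => (f x - s N x)%R) ^+ 2)%E @ \oo --> ((2 `^ p)%:E * B)%E.
    rewrite -[X in _ --> X]adde0; apply: cvgeD.
    - by rewrite fin_num_adde_defl.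
    - exact: cvg_cst.
    - rewrite -[X in _ --> X](mule0 C%:E); apply: cvgeZl => //.
      by rewrite -[X in _ --> X](mule0 0%E); apply: cvgeM.
  rewrite -(cvg_lim _ cvgb)//; apply: lime_ge; first by apply/cvg_ex; eexists; exact: cvgb.
  exact: nearW.
rewrite (_ : \int[mu]_x _ = \int[mu]_x limn (fun k => h k x))%E; last first.
  apply: eq_integral => x _; apply/esym/cvg_lim => //.
  apply: cvg_near_cst; near=> k; rewrite /h min_l//.
  near: k; exact: nbhs_infty_ger.
rewrite monotone_convergence//; apply: lime_le; last exact: nearW.
apply: ereal_nondecreasing_is_cvgn => a b ab; apply: ge0_le_integral => // x _.
exact: nd_h.
Unshelve. all: by end_near. Qed.

(** * Almost sure finiteness of the L^p norm *)

Theorem theorem2 (R : realType) (p : R)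
    (dY : measure_display) (Y : measurableType dY)
    (mu : {finite_measure set Y -> \bar R})
    (e : nat -> Y -> R[i])
    (dO : measure_display) (Omega : measurableType dO)
    (P : probability Omega R) (g : nat -> Omega -> R[i])
    (c : nat -> R[i]) (F : Omega * Y -> R[i]) :
  2 <= p ->
  orthonormal_basis mu e ->
  (forall n, complex_gaussian P 1 (g n)) ->
  cindependent P g ->
  (\sum_(n <oo) ((Normc.normc (c n)) ^+ 2)%:E < +oo)%E ->
  is_random_series P mu g c e F ->
  (\sum_(n <oo) ((Normc.normc (c n)) ^+ 2)%:E * cLnorm mu p (e n) ^+ 2 < +oo)%E ->
  {ae P, forall w, (cLnorm mu p (fun y => F (w, y)) < +oo)%E}.
Proof.
move=> p2 [e_Lp _ _] gauss_g indep_g _ [[mF _] cvgF] sum_lty.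
have p0 : 0 < p by apply: lt_le_trans p2.
have me n : cmeasurable (e n) := (e_Lp n).1.
have mg n : cmeasurable (g n) := (gauss_g n).1.
pose s N (z : Omega * Y) := \sum_(n < N) g n z.1 * c n * e n z.2.
have ms N : cmeasurable (s N).
  apply: (cmeasurable_sum N (fun n (z : Omega * Y) => g n z.1 * c n * e n z.2)) => n.
  apply: cmeasurableM.
    apply: cmeasurableM; last exact: cmeasurable_cst.
    exact: (cmeasurable_comp (g n) fst (mg n)).
  exact: (cmeasurable_comp (e n) snd (me n)).
set M := (\sum_(n <oo) _)%E in sum_lty.
have mv N : measurable_fun setT (fun y =>
    ((\sum_(n < N) Normc.normc (c n * e n y) ^+ 2) `^ (p / 2))%:E).
  apply/measurable_EFinP; apply: (measurableT_comp (measurable_powR (p / 2))).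
  apply: measurable_sum => n; apply: measurable_funX; apply: measurable_normc.
  by apply: cmeasurableM => //; exact: cmeasurable_cst.
have K0 : 0 <= moment_cst p by rewrite !mulr_ge0 ?powR_ge0 ?expR_ge0.
have sB N : (\int[P \x mu]_z (Normc.normc (s N z) `^ p)%:E <=
             (moment_cst p)%:E * M `^ (p / 2))%E.
  rewrite fubini_tonelli2//; last 2 first.
  - by apply/measurable_EFinP; exact: measurable_normc_powR.
  - by move=> z; rewrite lee_fin powR_ge0.
  apply: (@le_trans _ _ (\int[mu]_y ((moment_cst p)%:E *
      ((\sum_(n < N) Normc.normc (c n * e n y) ^+ 2) `^ (p / 2))%:E))%E).
    apply: ge0_le_integral => //.
    - by move=> y _; apply: integral_ge0 => w _; rewrite lee_fin powR_ge0.
    - apply: measurable_fun_fubini_tonelli_G => //.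
      + by apply/measurable_EFinP; exact: measurable_normc_powR.
      + by move=> z; rewrite lee_fin powR_ge0.
    - exact: measurable_funeM.
    - move=> y _; rewrite -EFinM.
      apply: le_trans (gaussian_csum_moment P g p (fun n => c n * e n y) N p0 gauss_g indep_g).
      rewrite /fubini_G /s /=; under eq_integral => w _.
        under eq_bigr do rewrite -mulrA.
        over.
      by [].
  rewrite ge0_integralZl_EFin//; last by move=> y _; rewrite lee_fin powR_ge0.
  by rewrite lee_wpmul2l ?lee_fin//; exact: integral_sum_sqr.
have FB := integral_powR_closed_L2 _ p F s _ p2 mF ms cvgF sB.
have mFp : measurable_fun setT (fun z => (Normc.normc (F z) `^ p)%:E).
  by apply/measurable_EFinP; exact: measurable_normc_powR.
have : (P \x mu)%E.-integrable setT (fun z => (Normc.normc (F z) `^ p)%:E).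
  apply/integrableP; split => //.
  under eq_integral do rewrite gee0_abs ?lee_fin ?powR_ge0//.
  apply: (le_lt_trans FB).
  by rewrite !lte_mul_pinfty ?mule_ge0 ?lee_fin ?poweR_ge0 ?powR_ge0 ?poweR_lty.
move=> /ae_integrable1; apply: filterS => w /integrableP[_].
under eq_integral do rewrite gee0_abs ?lee_fin ?powR_ge0//.
by move=> Fw; rewrite cLnormE poweR_lty.
Qed.
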